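(* Let $(\mathcal{X},d)$ be a finite metric space, $P$ a probability distribution on $\mathcal{X}$, $k\ge1$ an integer, and $O\in\mathcal{X}_k$ an optimal $k$-RP solution. Let $S$ be the random $k$-multiset returned by algorithm VRRP, i.e., $S\sim\widetilde{P}_k$. Then $$\mathbb{E}_{S\sim \widetilde{P}_k}\mathbb{E}_{X\sim P_k}[d_k(S,X)]\le 4\cdot \mathbb{E}_{X\sim P_k}[d_k(O,X)].$$
   Context: $\mathcal{X}_k$ is the set of multisets of exactly $k$ points of $\mathcal{X}$. For $U,V\in\mathcal{X}_k$, $d_k(U,V)$ is the minimum, over perfect matchings between the $k$ elements of $U$ and the $k$ elements of $V$ (with multiplicity), of the sum of the distances of matched pairs. $P_k$ is the distribution of the multiset of $k$ points drawn i.i.d. from $P$. The $k$-RP cost of $S\in\mathcal{X}_k$ is $\mathbb{E}_{X\sim P_k}[d_k(S,X)]$, and $O$ minimizes this cost. The variance-reduced distribution $\widetilde{P}_k$ on $\mathcal{X}_k$ (algorithm VRRP) is defined as follows: for each $x\in\mathcal{X}$ the multiset contains $\lfloor P(x)\cdot k\rfloor$ copies of $x$; each of the remaining $r=k-\sum_{x\in\mathcal{X}}\lfloor P(x)\cdot k\rfloor$ points (if $r>0$) is chosen independently, equal to $x$ with probability $\frac{P(x)-\lfloor P(x)k\rfloor/k}{\sum_{y\in\mathcal{X}}(P(y)-\lfloor P(y)k\rfloor/k)}$. *)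

(* Defs.v *)
From HB Require Import structures.
From mathcomp Require Import all_boot all_order all_algebra.
Set Implicit Arguments. Unset Strict Implicit. Unset Printing Implicit Defensive.
Import Order.TTheory GRing.Theory Num.Theory.
Local Open Scope ring_scope.

Section KRP.
Variables (R : archiRealFieldType) (T : finType).

Definition is_metric (d : T -> T -> R) : Prop :=
  [/\ forall x y, d x y = 0 <-> x = y,
      forall x y, d x y = d y x &
      forall x y z, d x z <= d x y + d y z].

Definition is_distr (P : T -> R) : Prop :=
  (forall x, 0 <= P x) /\ \sum_(x : T) P x = 1.

(* Multisets are represented by sequences (order irrelevant).  d_k U V is the
   minimum, over all reorderings V' of V (i.e. perfect matchings), of the sum of
   distances of matched pairs. *)
Definition match_cost (d : T -> T -> R) (U V : seq T) : R :=
  \sum_(p <- zip U V) d p.1 p.2.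

Definition dk (d : T -> T -> R) (U V : seq T) : R :=
  \big[Num.min/match_cost d U V]_(W <- permutations V) match_cost d U W.

Definition krp_cost (d : T -> T -> R) (P : T -> R) (k : nat) (S : seq T) : R :=
  \sum_(X : k.-tuple T) (\prod_(x <- X) P x) * dk d S X.

Definition vr_copies (P : T -> R) (k : nat) (x : T) : nat :=
  Num.truncn (P x * k%:R).

Definition vr_det (P : T -> R) (k : nat) : seq T :=
  flatten [seq nseq (vr_copies P k x) x | x <- enum T].

Definition vr_rem (P : T -> R) (k : nat) : nat :=
  (k - \sum_(x : T) vr_copies P k x)%N.

Definition vr_resid (P : T -> R) (k : nat) (x : T) : R :=
  (P x - (vr_copies P k x)%:R / k%:R) /
  \sum_(y : T) (P y - (vr_copies P k y)%:R / k%:R).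

Definition vrrp_expect (P : T -> R) (k : nat) (f : seq T -> R) : R :=
  \sum_(w : (vr_rem P k).-tuple T)
     (\prod_(x <- w) vr_resid P k x) * f (vr_det P k ++ w).

End KRP.

(* Main.v *)
(** The output of VRRP is a tuple of independent points [S_j] with laws [mu_j]
    (Dirac masses for the deterministic copies) whose average is [P].  By the
    triangle inequality it suffices to show [E d_k(S, O) <= 3 C], where
    [C = E d_k(O, X)].

    By Kantorovich duality [d_k(S, O) = phi_S(S) - phi_S(O)] for a 1-Lipschitz
    [phi_S].  Put [U = E phi_S(S)], [o = E phi_S(O)], and let [M] be the
    expectation of [phi_S(X)] for [X ~ P_k] independent of [S]; weak duality
    gives [o - M <= C].  On the other hand [P_k] is the mixture, over a uniform
    map [f] on the [k] indices, of the products of the [mu_(f i)].  Coupling [S]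
    and [X] so that every index [j] in the range of [f] has its [S_j] reused
    exactly once among the [X_i] gives [M + a (U - M) - o <= C], where
    [a = 1 - (1 - 1/k)^k >= 1/2] is the probability that [j] is in the range of
    [f].  Both inequalities together yield [U - o <= 3 C]. *)

Require Import Defs.
From HB Require Import structures.
From mathcomp Require Import all_boot all_order all_algebra.
From mathcomp Require Import perm zify ring lra.
Import Order.TTheory GRing.Theory Num.Theory.
Local Open Scope ring_scope.
Set Implicit Arguments. Unset Strict Implicit. Unset Printing Implicit Defensive.

(** * Potentials for weights without negative closed walks *)

Section Potential.
Variable R : realDomainType.

Fixpoint walk_weight (I : Type) (c : I -> I -> R) (x : I) (s : seq I) : R :=
  if s is y :: s' then c x y + walk_weight c y s' else 0.

Lemma walk_weight_cat (I : Type) (c : I -> I -> R) x s1 s2 :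
  walk_weight c x (s1 ++ s2) =
  walk_weight c x s1 + walk_weight c (last x s1) s2.
Proof. by elim: s1 x => [|y s1 IH] x /=; rewrite ?add0r // IH addrA. Qed.

(** One-dimensional Helly property: clamping a common point of the earlier intervals to [[f a, g a]]
    keeps it in all of them. *)
Lemma exists_between (I : eqType) (f g : I -> R) (s : seq I) :
  {in s &, forall i j, f i <= g j} ->
  exists v, {in s, forall i, f i <= v <= g i}.
Proof.
elim: s => [|a s IH] fg; first by exists 0.
have [|v vP] := IH; first by move=> i j si sj; apply: fg; rewrite inE ?si ?sj orbT.
exists (Num.max (f a) (Num.min v (g a))) => i; rewrite inE => /predU1P[->|si].
  by rewrite le_max lexx ge_max ge_min lexx orbT fg ?mem_head.
have sai : i \in a :: s by rewrite inE si orbT.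
have /andP[fv vg] := vP i si.
by rewrite le_max le_min fv (fg i a) ?mem_head // orbT ge_max ge_min vg (fg a i) ?mem_head.
Qed.

(* Eliminate the nodes one by one: allowing the shortcuts through [a] in the
   weights of the remaining edges creates no negative closed walk. *)
Lemma exists_potential (I : eqType) (c : I -> I -> R) (s : seq I) :
  uniq s -> (forall x p, last x p = x -> 0 <= walk_weight c x p) ->
  exists q : I -> R, {in s &, forall x y, q x - q y <= c x y}.
Proof.
elim: s c => [|a s IH] c /=; first by exists (fun=> 0).
case/andP=> as_ us c_ge0.
pose c' x y := Num.min (c x y) (c x a + c a y).
have [x p xp|q qP] := IH c' us.
  (* Replacing each edge whose minimum is the detour by two edges through [a] turns a walk for [c']
     into one for [c] with the same endpoints. *)
  suff [p' lp']: exists2 p', last x p' = last x p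
      & walk_weight c x p' <= walk_weight c' x p.
    by apply: le_trans; apply: c_ge0; rewrite lp'.
  elim: p x {xp} => [|y p IHp] x /=; first by exists [::].
  have [p' lp' wp'] := IHp y.
  rewrite /c'; case: leP => _; first by exists (y :: p') => //=; rewrite lerD2l.
  by exists [:: a, y & p'] => //=; rewrite addrA lerD2l.
have [i j si sj|v vP] := @exists_between _ (fun i => q i - c i a) (fun j => q j + c a j) s.
  have := qP i j si sj; rewrite /c' le_min => /andP[_]; lra.
exists (fun x => if x == a then v else q x) => x y.
rewrite !inE; case: eqVneq => [->|_] /=; case: eqVneq => [->|_] //=.
- by move=> _ _; rewrite subrr; have := c_ge0 a [:: a] erefl; rewrite /= addr0.
- by move=> _ /vP /andP[_]; lra.
- by move=> /vP /andP[+ _] _; lra.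
by move=> sx sy; have := qP x y sx sy; rewrite /c' le_min => /andP[].
Qed.

Lemma walk_weight_next_at (I : eqType) (c : I -> I -> R) y0 y p :
  uniq (y :: p) ->
  walk_weight c y (rcons p y0) = \sum_(z <- y :: p) c z (next_at z y0 y p).
Proof.
elim: p y => [|y' p IH] y.
  by rewrite big_seq1 /= eqxx addr0.
move=> uyp; rewrite big_cons /= eqxx IH; last by case/andP: uyp.
congr (_ + _); apply: eq_big_seq => z zp.
by case: eqVneq => // zy; move: uyp; rewrite -zy /= zp.
Qed.

(** A closed walk without repetition is a cycle of a permutation fixing all other nodes, which cost
    0. A repeated node splits the walk into two shorter closed walks. *)
Lemma closed_walk_ge0 (I : finType) (c : I -> I -> R) :
  (forall x, c x x = 0) -> (forall s : {perm I}, 0 <= \sum_x c x (s x)) ->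
  forall x p, last x p = x -> 0 <= walk_weight c x p.
Proof.
move=> c0 cs x p; have [n] := ubnP (size p).
elim: n x p => // n IH x p; rewrite ltnS => pn xp.
have [up|/uniqPn] := boolP (uniq p).
  case/lastP: p up pn xp => [|t z] //; rewrite last_rcons => + _ zx.
  rewrite {z}zx rcons_uniq => uxt'; have uxt : uniq (x :: t) by [].
  rewrite walk_weight_next_at //.
  have := cs (perm (can_inj (prev_next uxt))).
  rewrite (bigID (mem (x :: t))) /= [X in _ + X]big1 ?addr0.
    rewrite -big_uniq //= => /le_trans; apply; rewrite le_eqVlt; apply/orP; left.
    by apply/eqP; apply: eq_bigr => i _; rewrite permE.
  by move=> i /negbTE it; rewrite permE next_nth it c0.
move=> /(_ x)[i [j [ij jp eq_ij]]].
have ip : (i < size p)%N by apply: ltn_trans jp.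
set y := nth x p i in eq_ij.
have pE : p = take i p ++ y :: (take (j - i.+1) (drop i.+1 p) ++ y :: drop j.+1 p).
  rewrite -{1}(cat_take_drop i p) (drop_nth x ip); congr (_ ++ _ :: _).
  rewrite -{1}(cat_take_drop (j - i.+1) (drop i.+1 p)) drop_drop subnK //.
  by rewrite (drop_nth x jp) -eq_ij.
move: (take i p) (take _ (drop _ p)) (drop j.+1 p) pE => p1 p2 p3 pE.
clearbody y; subst p.
rewrite walk_weight_cat /= walk_weight_cat /=.
move: xp; rewrite last_cat /= last_cat /= => xp.
have h1 : 0 <= walk_weight c x (p1 ++ y :: p3).
  by apply: IH; [move: pn; rewrite size_cat size_cat /= ?size_cat /=; lia | rewrite last_cat].
have h2 : 0 <= walk_weight c y (rcons p2 y).
  by apply: IH; [move: pn; rewrite size_rcons size_cat /= size_cat /=; lia | rewrite last_rcons].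
move: h1 h2; rewrite -cats1 !walk_weight_cat /=; lra.
Qed.

End Potential.

(** * Kantorovich duality for [dk] *)

Section Duality.
Variables (R : archiRealFieldType) (T : finType) (d : T -> T -> R).
Hypothesis d_metric : is_metric d.

Definition lipschitz1 (phi : T -> R) := forall x y, phi x - phi y <= d x y.

Lemma lipschitz1_0 : lipschitz1 (fun=> 0).
Proof.
have [d0 d_sym d_tri] := d_metric.
move=> x y; have := d_tri x y x; rewrite (d0 x x).2 // (d_sym y x); lra.
Qed.

Lemma lipschitz1N phi : lipschitz1 phi -> lipschitz1 (fun x => - phi x).
Proof.
by case: d_metric => _ d_sym _ phiL x y; rewrite opprK addrC d_sym.
Qed.

Lemma match_cost_tuple k (U V : k.-tuple T) :
  match_cost d U V = \sum_i d (tnth U i) (tnth V i).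
Proof.
rewrite /match_cost (big_tuple _ _ (zip_tuple U V)); apply: eq_bigr => i _.
have x0 := tnth U i; rewrite (tnth_nth (x0, x0)) /= nth_zip ?size_tuple //=.
by rewrite !(tnth_nth x0).
Qed.

Lemma dk_le_match_cost (U V W : seq T) :
  perm_eq W V -> dk d U V <= match_cost d U W.
Proof. by move=> WV; rewrite /dk ge_bigmin_seq ?mem_permutations. Qed.

Lemma dk_attained (U V : seq T) :
  exists2 W, perm_eq W V & dk d U V = match_cost d U W.
Proof.
rewrite /dk big_seq; apply: (big_ind (fun v => exists2 W, perm_eq W V & v = _ W));
  first by exists V.
  by move=> x y [W WV ->] [W' WV' ->]; case: leP; [exists W | exists W'].
by move=> W; rewrite mem_permutations; exists W.
Qed.

(** Weak duality: in any matching, each pair costs at least its difference of [phi]. *)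
Lemma dk_ge_lipschitz k (U V : k.-tuple T) phi :
  lipschitz1 phi ->
  \sum_(x <- U) phi x - \sum_(x <- V) phi x <= dk d U V.
Proof.
move=> phiL; have [W WV ->] := dk_attained U V.
have szW : size W == k by rewrite (perm_size WV) size_tuple.
rewrite -(perm_big _ WV) /= -[W]/(tval (Tuple szW)) match_cost_tuple.
by rewrite !big_tuple -sumrB; apply: ler_sum.
Qed.

Lemma dk_ge0 k (U V : k.-tuple T) : 0 <= dk d U V.
Proof.
by have := dk_ge_lipschitz U V lipschitz1_0; rewrite !big1 ?subrr.
Qed.

(* Kantorovich duality: optimality of the matching means that no cyclic exchange
   improves it, and a potential of the exchange costs yields [phi]. *)
Lemma dk_dual k (U V : k.-tuple T) :
  exists2 phi, lipschitz1 phi &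
    dk d U V = \sum_(x <- U) phi x - \sum_(x <- V) phi x.
Proof.
have [d0 d_sym d_tri] := d_metric.
have [W WV dkE] := dk_attained U V.
have szW : size W == k by rewrite (perm_size WV) size_tuple.
pose Wt := Tuple szW.
pose u i := tnth U i; pose w i := tnth Wt i.
have {}dkE : dk d U V = \sum_i d (u i) (w i) by rewrite dkE (match_cost_tuple U Wt).
pose c i j := d (u i) (w j) - d (u i) (w i).
have cs (s : {perm 'I_k}) : 0 <= \sum_i c i (s i).
  rewrite sumrB subr_ge0 -dkE.
  have -> : \sum_i d (u i) (w (s i)) = match_cost d U [tuple w (s i) | i < k].
    by rewrite match_cost_tuple; apply: eq_bigr => i _; rewrite tnth_mktuple.
  apply: dk_le_match_cost; apply: perm_trans WV.
  suff : perm_eq [tuple w (s i) | i < k] Wt by [].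
  by apply/tuple_permP; exists s.
have c0 i : c i i = 0 by rewrite /c subrr.
have [q qP] := exists_potential (index_enum_uniq 'I_k) (closed_walk_ge0 c0 cs).
have {}qP i j : q i - q j <= c i j by apply: qP; rewrite mem_index_enum.
have [phi [phiL phiP]] : exists phi, lipschitz1 phi /\ forall i, d (u i) (w i) <= phi (u i) - phi (w i).
  have [j0 _|no_j] := pickP 'I_k; last first.
    by exists (fun=> 0); split; [exact: lipschitz1_0 | move=> i; have := no_j i].
  (* The lower envelope of the [h x i] is 1-Lipschitz as a minimum of 1-Lipschitz functions. It is
     at most [q i] at [w i], and the potential inequality for [q] makes it at least
     [d (u i) (w i) + q i] at [u i]. *)
  pose h x i := d x (w i) + q i.
  exists (fun x => \big[Num.min/h x j0]_i h x i); split.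
    move=> x y; rewrite lerBlDl -lerBlDr.
    apply: le_bigmin => [|i _]; rewrite lerBlDr.
      by apply: le_trans (bigmin_le _ j0 _) _; rewrite /h; have := d_tri x y (w j0); lra.
    by apply: le_trans (bigmin_le _ i _) _; rewrite /h; have := d_tri x y (w i); lra.
  move=> i; rewrite lerBrDr.
  apply: (@le_trans _ _ (d (u i) (w i) + q i)).
    rewrite lerD2l; apply: le_trans (bigmin_le _ i _) _.
    by rewrite /h (d0 (w i) (w i)).2 // add0r.
  by apply: le_bigmin => [|j _]; rewrite /h; [have := qP i j0|have := qP i j]; rewrite /c; lra.
exists phi => //; apply/eqP; rewrite eq_le dk_ge_lipschitz // andbT dkE.
have -> : \sum_(x <- V) phi x = \sum_(x <- Wt) phi x by apply/esym/perm_big.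
rewrite !big_tuple -sumrB.
exact: ler_sum.
Qed.

(** Insert the sum over [V] into the dual form of [dk d U W] and use weak duality twice. *)
Lemma dk_triangle k (U V W : k.-tuple T) : dk d U W <= dk d U V + dk d V W.
Proof.
have [phi phiL ->] := dk_dual U W.
have := dk_ge_lipschitz U V phiL; have := dk_ge_lipschitz V W phiL; lra.
Qed.

End Duality.

(** * Expectations over independent coordinates *)

Section ProductExpectation.
Variable R : numFieldType.

Definition prodE (I T : finType) (mu : I -> T -> R) (F : {ffun I -> T} -> R) : R :=
  \sum_(z : {ffun I -> T}) (\prod_i mu i (z i)) * F z.

Lemma eq_prodE (I T : finType) (mu : I -> T -> R) (F G : {ffun I -> T} -> R) :
  F =1 G -> prodE mu F = prodE mu G.
Proof. by move=> FG; apply: eq_bigr => z _; rewrite FG. Qed.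

Lemma prodE_sum (I T : finType) (mu : I -> T -> R) (J : finType)
    (F : J -> {ffun I -> T} -> R) :
  prodE mu (fun z => \sum_j F j z) = \sum_j prodE mu (F j).
Proof. by rewrite exchange_big; apply: eq_bigr => z _; rewrite big_distrr. Qed.

Lemma prodEB (I T : finType) (mu : I -> T -> R) (F G : {ffun I -> T} -> R) :
  prodE mu (fun z => F z - G z) = prodE mu F - prodE mu G.
Proof. by rewrite -sumrB; apply: eq_bigr => z _; rewrite mulrBr. Qed.

Lemma prodED (I T : finType) (mu : I -> T -> R) (F G : {ffun I -> T} -> R) :
  prodE mu (fun z => F z + G z) = prodE mu F + prodE mu G.
Proof. by rewrite -big_split; apply: eq_bigr => z _; rewrite mulrDr. Qed.

Lemma prodEZ (I T : finType) (mu : I -> T -> R) c (F : {ffun I -> T} -> R) :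
  prodE mu (fun z => c * F z) = c * prodE mu F.
Proof. by rewrite big_distrr; apply: eq_bigr => z _; rewrite /= mulrCA. Qed.

Lemma prodE_le (I T : finType) (mu : I -> T -> R) (F G : {ffun I -> T} -> R) :
  (forall i x, 0 <= mu i x) -> (forall z, F z <= G z) ->
  prodE mu F <= prodE mu G.
Proof.
by move=> mu0 FG; apply: ler_sum => z _; apply: ler_wpM2l => //; apply: prodr_ge0.
Qed.

Lemma prodE_prod (I T : finType) (mu h : I -> T -> R) :
  prodE mu (fun z => \prod_i h i (z i)) = \prod_i \sum_x mu i x * h i x.
Proof. by rewrite bigA_distr_bigA; apply: eq_bigr => z _; rewrite big_split. Qed.

Lemma prodE_cst (I T : finType) (mu : I -> T -> R) c :
  (forall i, \sum_x mu i x = 1) -> prodE mu (fun=> c) = c.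
Proof.
by move=> mu1; rewrite /prodE -big_distrl /= -bigA_distr_bigA big1 ?mul1r.
Qed.

Lemma prodE_comp (I J T : finType) (g : J -> I) (mu : I -> T -> R)
    (F : {ffun J -> T} -> R) :
  injective g -> (forall i, \sum_x mu i x = 1) ->
  prodE mu (fun z => F [ffun j => z (g j)]) = prodE (fun j => mu (g j)) F.
Proof.
move=> g_inj mu1; rewrite /prodE.
rewrite (partition_big (fun z : {ffun I -> T} => [ffun j => z (g j)]) predT) //=.
apply: eq_bigr => y _.
(* The fibre over [y] is a product set, with [Q i] the values allowed at [i]. So its mass factors,
   and coordinates outside the range of [g] contribute total mass 1. *)
pose Q i := [pred x | [forall j, (g j == i) ==> (x == y j)]].
transitivity (\sum_(z in family Q) (\prod_i mu i (z i)) * F y).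
  apply: eq_big => [z|z /eqP -> //].
  apply/eqP/familyP => [zy i|zQ].
    by apply/forallP => j; apply/implyP => /eqP <-; rewrite -zy ffunE.
  apply/ffunP => j; rewrite ffunE.
  by have /forallP/(_ j) := zQ (g j); rewrite eqxx => /eqP.
rewrite -big_distrl -bigA_distr_big_dep /=; congr (_ * _).
rewrite (bigID (mem (codom g))) /= [X in _ * X]big1 ?mulr1.
  rewrite -big_uniq ?(map_inj_uniq g_inj) ?enum_uniq //= big_map big_enum /=.
  apply: eq_bigr => j _; rewrite (big_pred1 (y j)) // => x /=.
  apply/forallP/eqP => [/(_ j)|-> j']; first by rewrite eqxx => /eqP.
  by apply/implyP => /eqP/g_inj ->.
move=> i iNg; rewrite -[RHS](mu1 i); apply: eq_bigl => x.
apply/forallP => j; apply/implyP => /eqP ji; case/negP: iNg.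
by rewrite -ji codom_f.
Qed.

Lemma prodE_split (I T : finType) (mu : unit + I -> T -> R)
    (F : T -> {ffun I -> T} -> R) :
  prodE mu (fun z => F (z (inl tt)) [ffun i => z (inr i)]) =
  \sum_t mu (inl tt) t * prodE (fun i => mu (inr i)) (F t).
Proof.
under [RHS]eq_bigr do rewrite /prodE big_distrr /=.
rewrite pair_big /=.
pose h (p : T * {ffun I -> T}) : {ffun unit + I -> T} :=
  [ffun o => if o is inr i then p.2 i else p.1].
have h_bij : bijective h.
  exists (fun z : {ffun unit + I -> T} => (z (inl tt), [ffun i => z (inr i)])) => [[t y]|z].
    by rewrite /h ffunE /=; congr (_, _); apply/ffunP => i; rewrite !ffunE.
  by apply/ffunP => -[[]|i]; rewrite !ffunE.
rewrite /prodE (reindex h) /=; last exact: onW_bij.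
apply: eq_bigr => -[t y] _ /=; rewrite mulrA big_sumType /=.
congr (_ * _ * F _ _); last by apply/ffunP => i; rewrite !ffunE.
- by rewrite (big_pred1 tt) ?ffunE // => -[].
- by apply: eq_bigr => i _; rewrite ffunE.
by rewrite ffunE.
Qed.

Lemma prodE_indep (I J T : finType) (i0 : I) (g : J -> I) (mu : I -> T -> R)
    (F : T -> {ffun J -> T} -> R) :
  injective g -> (forall j, g j != i0) -> (forall i, \sum_x mu i x = 1) ->
  prodE mu (fun z => F (z i0) [ffun j => z (g j)]) =
  \sum_t mu i0 t * prodE (fun j => mu (g j)) (F t).
Proof.
move=> g_inj gN mu1.
pose g' (o : unit + J) := if o is inr j then g j else i0.
have g'_inj : injective g'.
  move=> [[]|j] [[]|j'] //= e; first by have := gN j'; rewrite -e eqxx.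
    by have := gN j; rewrite e eqxx.
  by rewrite (g_inj _ _ e).
rewrite -(prodE_split (fun o => mu (g' o))) -(prodE_comp _ g'_inj mu1).
apply: eq_prodE => z; rewrite ffunE; congr F.
by apply/ffunP => j; rewrite !ffunE.
Qed.

Lemma prodE_marginal (I T : finType) (mu : I -> T -> R) i (h : T -> R) :
  (forall i, \sum_x mu i x = 1) ->
  prodE mu (fun z => h (z i)) = \sum_t mu i t * h t.
Proof.
move=> mu1.
rewrite (@prodE_indep _ void _ i (of_void I) mu (fun t _ => h t)) //; try by case.
by apply: eq_bigr => t _; rewrite prodE_cst //; case.
Qed.

(** Expanding the product of sums amounts to drawing a component [f i] with weights [a] for each
    coordinate first. *)
Lemma prodE_mixture (I J T : finType) (a : J -> R) (mu : J -> T -> R)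
    (F : {ffun I -> T} -> R) :
  prodE (fun _ x => \sum_j a j * mu j x) F =
  prodE (fun _ : I => a) (fun f => prodE (fun i => mu (f i)) F).
Proof.
rewrite /prodE; under eq_bigr do rewrite bigA_distr_bigA big_distrl /=.
rewrite exchange_big; apply: eq_bigr => f _ /=.
by rewrite big_distrr; apply: eq_bigr => x _; rewrite /= big_split mulrA.
Qed.

End ProductExpectation.

(** Bernoulli gives [(1 + x) ^+ n >= 2], while the product of both powers is
    [(1 - x ^+ 2) ^+ n <= 1]. *)
Lemma exp1Bn_le_half (R : realFieldType) n (x : R) :
  0 <= x <= 1 -> 1 <= n%:R * x -> (1 - x) ^+ n <= 2^-1.
Proof.
move=> /andP[x0 x1] nx.
have bernoulli : 1 + n%:R * x <= (1 + x) ^+ n.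
  elim: n {nx} => [|n IH]; first by rewrite mul0r addr0 expr0.
  have x1' : 0 <= 1 + x by lra.
  rewrite exprS; apply: le_trans (ler_wpM2l x1' IH).
  have : 0 <= n%:R * x * x by rewrite !mulr_ge0.
  rewrite -natr1; nra.
have le1 : (1 - x) ^+ n * (1 + x) ^+ n <= 1.
  rewrite -exprMn; apply: exprn_ile1; nra.
have : 0 <= (1 - x) ^+ n by rewrite exprn_ge0 //; lra.
nra.
Qed.

(** * Coupling bounds for independent points with average law [P] *)

Section Coupling.
Variables (R : archiRealFieldType) (T : finType) (d : T -> T -> R).
Hypothesis d_metric : is_metric d.
Variables (k : nat) (mu : 'I_k -> T -> R) (O : k.-tuple T).
Hypothesis mu_ge0 : forall j x, 0 <= mu j x.
Hypothesis mu_sum1 : forall j, \sum_x mu j x = 1.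

Local Notation tup X := [tuple X i | i < k].

Lemma sum_mktuple (phi : T -> R) (X : 'I_k -> T) :
  \sum_(x <- tup X) phi x = \sum_i phi (X i).
Proof. by rewrite big_tuple; apply: eq_bigr => i _; rewrite tnth_mktuple. Qed.

Lemma dk_ge_lipschitzC (U V : k.-tuple T) phi :
  lipschitz1 d phi -> \sum_(x <- V) phi x - \sum_(x <- U) phi x <= dk d U V.
Proof.
move=> /(lipschitz1N d_metric)/(dk_ge_lipschitz U V).
by rewrite !sumrN opprK addrC.
Qed.

(** Selects the one index [i] at which [X i] reuses [S j]. The default [j] is harmless: if [f]
    misses [j], no [X i] reads row [j] of the grid. *)
Definition preimage_sel (f : 'I_k -> 'I_k) (j : 'I_k) : 'I_k :=
  if [pick i | f i == j] is Some i then i else j.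

Variable phi : {ffun 'I_k -> T} -> T -> R.
Hypothesis phi_lip : forall S, lipschitz1 d (phi S).

(** Mean potential at the sample's own point [S j], at an independent point of law [mu j], and over
    [O]; [u] and [m] sum to the [U] and [M] of the overview. *)
Let u j := prodE mu (fun S => phi S (S j)).
Let m j := \sum_t mu j t * prodE mu (fun S => phi S t).
Let o := prodE mu (fun S => \sum_(x <- O) phi S x).

(* On a grid of independent [z (j, i)] with law [mu j], the sample
   [X i = z (f i, i)] has law [prod_i mu (f i)], the sample
   [S j = z (j, preimage_sel f j)] has law [prod_j mu j], and [X i] is either
   [S (f i)] or independent of [S]. *)
Lemma coupling_bound (f : 'I_k -> 'I_k) :
  \sum_i (if preimage_sel f (f i) == i then u (f i) else m (f i)) - o <=
  prodE (fun i => mu (f i)) (fun X => dk d O (tup X)).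
Proof.
pose nu (p : 'I_k * 'I_k) := mu p.1.
have nu1 p : \sum_x nu p x = 1 by exact: mu_sum1.
pose gX i := (f i, i); pose gS j := (j, preimage_sel f j).
have gX_inj : injective gX by move=> i j [].
have gS_inj : injective gS by move=> i j [].
pose Sof (z : {ffun 'I_k * 'I_k -> T}) := [ffun j => z (gS j)].
rewrite -[leRHS](prodE_comp _ gX_inj (mu := nu)) //.
have -> : o = prodE nu (fun z => \sum_(x <- O) phi (Sof z) x).
  by rewrite (prodE_comp (fun S => \sum_(x <- O) phi S x) gS_inj nu1).
have -> : \sum_i (if preimage_sel f (f i) == i then u (f i) else m (f i)) =
    prodE nu (fun z => \sum_i phi (Sof z) (z (gX i))).
  rewrite prodE_sum; apply: eq_bigr => i _; case: eqP => [sel|nsel].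
    rewrite /u -(prodE_comp (fun S => phi S (S (f i))) gS_inj nu1).
    by apply: eq_prodE => z; rewrite ffunE /gS sel.
  rewrite (prodE_indep (fun t S => phi S t) gS_inj _ nu1) // => j.
  by apply/eqP => -[ji ?]; apply: nsel; rewrite -ji.
rewrite -prodEB; apply: prodE_le => [p x|z]; first exact: mu_ge0.
apply: le_trans (dk_ge_lipschitzC O _ (phi_lip (Sof z))).
by rewrite sum_mktuple lerB // ler_sum // => i _; rewrite ffunE.
Qed.

(** Each [j] in the range of [f] is reused at exactly one [i], which adds [u j - m j]. The factor
    [1 - \prod_i (f i != j)%:R] is the indicator of that range. *)
Lemma sum_preimage_sel (f : {ffun 'I_k -> 'I_k}) :
  \sum_i (if preimage_sel f (f i) == i then u (f i) else m (f i)) =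
  \sum_i m (f i) + \sum_j (u j - m j) * (1 - \prod_i (f i != j)%:R).
Proof.
transitivity (\sum_i (m (f i) +
    (if preimage_sel f (f i) == i then u (f i) - m (f i) else 0))).
  by apply: eq_bigr => i _; case: ifP => _; rewrite ?addr0 // addrC subrK.
rewrite big_split; congr (_ + _).
rewrite (partition_big f predT) //=; apply: eq_bigr => j _.
transitivity (\sum_(i | f i == j) (u j - m j) * (preimage_sel f j == i)%:R).
  by apply: eq_bigr => i /eqP ->; case: eqP; rewrite ?mulr1 ?mulr0.
rewrite -big_distrr /=; congr (_ * _).
rewrite /preimage_sel; case: pickP => [i0 fi0|no_i].
  rewrite (bigD1 i0) //= eqxx big1 => [|i /andP[_ /negbTE]].
    by rewrite (bigD1 i0) //= fi0 mul0r subr0 addr0.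
  by rewrite eq_sym => ->.
rewrite big_pred0 // big1 ?subrr // => i _.
by rewrite no_i.
Qed.

Hypothesis k_gt0 : (0 < k)%N.
Variable P : T -> R.
Hypothesis P_avg : forall x, P x = \sum_j k%:R^-1 * mu j x.

Let C := prodE (fun _ : 'I_k => P) (fun X => dk d O (tup X)).

Let k_neq0 : k%:R != 0 :> R. Proof. by rewrite pnatr_eq0 -lt0n. Qed.
Let unif1 : 'I_k -> \sum_(j < k) k%:R^-1 = 1 :> R.
Proof. by rewrite sumr_const card_ord -[LHS]mulr_natl mulfV. Qed.

Lemma cost_ge0 : 0 <= C.
Proof.
apply: sumr_ge0 => X _; apply: mulr_ge0; last exact: dk_ge0.
apply: prodr_ge0 => i _; rewrite P_avg; apply: sumr_ge0 => j _.
by rewrite mulr_ge0 ?invr_ge0.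
Qed.

Lemma cost_ge_coupling :
  \sum_j m j + (1 - (1 - k%:R^-1) ^+ k) * (\sum_j u j - \sum_j m j) - o <= C.
Proof.
pose a (_ : 'I_k) : R := k%:R^-1.
have CE : C = prodE (fun _ : 'I_k => a)
    (fun f => prodE (fun i => mu (f i)) (fun X => dk d O (tup X))).
  rewrite -prodE_mixture; apply: eq_bigr => X _; congr (_ * _).
  by apply: eq_bigr => i _; rewrite P_avg.
have a0 (i j : 'I_k) : 0 <= a j by rewrite invr_ge0.
have a1 (i : 'I_k) : \sum_j a j = 1 by exact: unif1.
rewrite CE; apply: le_trans (prodE_le a0 (fun f => coupling_bound f)).
rewrite prodEB (prodE_cst _ a1) lerB // (eq_prodE _ (fun f => sum_preimage_sel f)).
rewrite prodED !prodE_sum lerD //.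
  under [leRHS]eq_bigr do rewrite (prodE_marginal _ _ a1) -mulr_sumr.
  by rewrite sumr_const card_ord -[leRHS]mulr_natl mulrA mulfV // mul1r.
rewrite -sumrB mulrC mulr_suml; apply: ler_sum => j _.
(* The [f i] are independent, so [j] is missed with probability [b ^+ k], where [b] is the chance
   that one uniform index differs from [j]. *)
rewrite prodEZ prodEB (prodE_cst _ a1) (prodE_prod _ (fun _ t => (t != j)%:R)).
rewrite prodr_const card_ord; set b := \sum_(x < _) _.
suff -> : b = 1 - k%:R^-1 by [].
apply: (addIr k%:R^-1); rewrite subrK -[RHS](unif1 j) /b (bigD1 j) //=.
rewrite eqxx mulr0 add0r addrC [RHS](bigD1 j) //=; congr (_ + _).
by apply: eq_bigr => i ->; rewrite mulr1.
Qed.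

Lemma cost_ge_mean : o - \sum_j m j <= C.
Proof.
have P1 (i : 'I_k) : \sum_x P x = 1.
  under eq_bigr do rewrite P_avg.
  rewrite exchange_big; under eq_bigr do rewrite -mulr_sumr mu_sum1 mulr1.
  exact: unif1.
have P0 (i : 'I_k) x : 0 <= P x.
  by rewrite P_avg sumr_ge0 // => j _; rewrite mulr_ge0 ?invr_ge0.
rewrite -[leRHS](prodE_cst (mu := mu)) //.
have -> : \sum_j m j = prodE mu (fun S => prodE (fun _ : 'I_k => P)
    (fun X => \sum_i phi S (X i))).
  (* Each of the [k] points of [X] has law [P], and [k] times [P] is the sum of the [mu j]. *)
  transitivity (prodE mu (fun S => k%:R * \sum_t P t * phi S t)).
    rewrite prodEZ prodE_sum.
    under [in RHS]eq_bigr do rewrite prodEZ P_avg mulr_suml.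
    rewrite [in RHS]exchange_big mulr_sumr; apply: eq_bigr => j _.
    rewrite mulr_sumr; apply: eq_bigr => t _.
    by rewrite !mulrA mulfV // mul1r.
  apply: eq_prodE => S; rewrite prodE_sum.
  under [RHS]eq_bigr do rewrite (prodE_marginal _ _ P1).
  by rewrite sumr_const card_ord mulr_natl.
rewrite -prodEB; apply: prodE_le => // S.
rewrite -[X in X - _](prodE_cst _ P1) -prodEB; apply: prodE_le => // X.
by rewrite -sum_mktuple dk_ge_lipschitz.
Qed.

Lemma expect_potential_le : \sum_j u j - o <= 3 * C.
Proof.
have C0 := cost_ge0; have Cm := cost_ge_mean; have := cost_ge_coupling.
have k1 : 1 <= k%:R :> R by rewrite ler1n.
have half : (1 - k%:R^-1) ^+ k <= 2^-1 :> R.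
  by apply: exp1Bn_le_half; rewrite ?mulfV // invr_ge0 invf_le1 ?ltr0n // k1 ler0n.
have : 0 <= (1 - k%:R^-1) ^+ k :> R by rewrite exprn_ge0 // subr_ge0 invf_le1 ?ltr0n.
move: half; set q := (_ ^+ _); move: (\sum_j u j) (\sum_j m j) Cm => U M.
(* Here [q] is [1 - a]. The coupling bound gives [U - o <= C + q * (U - M)]. If [M <= U], then
   [q <= 1 - q], and adding both cost bounds yields [(1 - q) * (U - M) <= 2 * C]. If [U < M], the
   term with [q >= 0] is at most 0. *)
case: (leP M U); nra.
Qed.

End Coupling.

Lemma expect_dk_le (R : archiRealFieldType) (T : finType) (d : T -> T -> R)
    (k : nat) (mu : 'I_k -> T -> R) (P : T -> R) (O : k.-tuple T) :
  is_metric d -> (0 < k)%N ->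
  (forall j x, 0 <= mu j x) -> (forall j, \sum_x mu j x = 1) ->
  (forall x, P x = \sum_j k%:R^-1 * mu j x) ->
  prodE mu (fun S => dk d [tuple S i | i < k] O) <=
  3 * prodE (fun _ : 'I_k => P) (fun X => dk d O [tuple X i | i < k]).
Proof.
move=> dm k0 mu0 mu1 Pavg.
have [phi phiP] := fin_all_exists2 (fun S : {ffun 'I_k -> T} => dk_dual dm [tuple S i | i < k] O).
move=> dkE; apply: le_trans (expect_potential_le dm O mu0 mu1 phiP k0 Pavg).
by rewrite -prodE_sum -prodEB; apply: prodE_le => // S; rewrite dkE sum_mktuple.
Qed.

Lemma sum_tuple_ffun (V : nmodType) (T : finType) n (H : n.-tuple T -> V) :
  \sum_(w : n.-tuple T) H w = \sum_(y : {ffun 'I_n -> T}) H [tuple y i | i < n].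
Proof.
rewrite (reindex (fun y : {ffun 'I_n -> T} => [tuple y i | i < n])) //.
apply: onW_bij; exists (fun w : n.-tuple T => [ffun i => tnth w i]) => [y|w].
  by apply/ffunP => i; rewrite ffunE tnth_mktuple.
by apply: eq_from_tnth => i; rewrite tnth_mktuple ffunE.
Qed.

(** * Deterministic points followed by i.i.d. ones, as a product law *)

Section DeterministicPrefix.
Variables (R : numFieldType) (T : finType) (x0 : T) (D : seq T) (Q : T -> R).

Definition prefix_law (j : nat) (x : T) : R :=
  if (j < size D)%N then (x == nth x0 D j)%:R else Q x.

Lemma prefix_law_ge0 j x : (forall x, 0 <= Q x) -> 0 <= prefix_law j x.
Proof. by move=> Q0; rewrite /prefix_law; case: ifP. Qed.

(** Normalisation of [Q] is asked only for [0 < r], since the residual law of VRRP is identically 0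
    when no point remains. *)
Lemma sum_prefix_law_eq1 k r (j : 'I_k) :
  (size D + r)%N = k -> ((0 < r)%N -> \sum_x Q x = 1) ->
  \sum_x prefix_law j x = 1.
Proof.
move=> e Q1; rewrite /prefix_law; have [jn|nj] := ltnP j (size D).
  by rewrite (bigD1 (nth x0 D j)) //= eqxx big1 ?addr0 // => x /negbTE ->.
by apply: Q1; have := ltn_ord j; lia.
Qed.

Lemma sum_prefix_law k r x :
  (size D + r)%N = k ->
  \sum_(j < k) prefix_law j x = (count_mem x D)%:R + r%:R * Q x.
Proof.
move=> <-; rewrite big_split_ord /=; congr (_ + _); last first.
  under eq_bigr do rewrite /prefix_law ltnNge leq_addr /=.
  by rewrite sumr_const card_ord mulr_natl.
rewrite -sum1_count natr_sum [RHS]big_mkcond [RHS](big_nth x0) [RHS]big_mkord /=.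
by apply: eq_bigr => i _; rewrite /prefix_law ltn_ord eq_sym; case: eqP.
Qed.

(** Tuples deviating from [D] on the prefix have a zero Dirac factor; on the others the prefix
    integrates out. *)
Lemma prodE_prefix_law k r (F : seq T -> R) :
  (size D + r)%N = k -> ((0 < r)%N -> \sum_x Q x = 1) ->
  prodE (fun j : 'I_k => prefix_law j) (fun S => F [tuple S i | i < k]) =
  \sum_(w : r.-tuple T) (\prod_(x <- w) Q x) * F (D ++ w).
Proof.
move=> e Q1; have mu1 j := sum_prefix_law_eq1 j e Q1.
case: k / e mu1 => mu1; rewrite sum_tuple_ffun.
pose G (y : {ffun 'I_r -> T}) := F (D ++ [tuple y i | i < r]).
transitivity (prodE (fun j : 'I_(size D + r) => prefix_law j)
    (fun S => G [ffun i => S (rshift (size D) i)])).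
  apply: eq_bigr => S _.
  have [SD|/forallPn[i SDi]] := boolP [forall i, S (lshift r i) == nth x0 D i].
    congr (_ * F _).
    apply: (@eq_from_nth _ x0) => [|l]; first by rewrite size_cat !size_tuple.
    rewrite size_tuple => lk; rewrite nth_cat -(tnth_nth x0 _ (Ordinal lk)) tnth_mktuple.
    have [lD|Dl] := ltnP l (size D).
      rewrite -(eqP (forallP SD (Ordinal lD))); congr (S _); exact: val_inj.
    have lr : (l - size D < r)%N by lia.
    rewrite -(tnth_nth x0 _ (Ordinal lr)) tnth_mktuple ffunE; congr (S _).
    by apply: val_inj; rewrite /= subnKC.
  rewrite (bigD1 (lshift r i)) //= /prefix_law /= ltn_ord (negbTE SDi).
  by rewrite !mul0r.
rewrite (prodE_comp G (@rshift_inj _ _) mu1).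
apply: eq_bigr => y _; rewrite big_tuple; congr (_ * _).
by apply: eq_bigr => i _; rewrite tnth_mktuple /prefix_law /= ltnNge leq_addr.
Qed.

End DeterministicPrefix.

(** * Sizes and residuals of the VRRP sample *)

Section VarianceReduced.
Variables (R : archiRealFieldType) (T : finType) (P : T -> R) (k : nat).
Hypothesis P_distr : is_distr P.
Hypothesis k_gt0 : (0 < k)%N.

Let c := vr_copies P k.

Let k_neq0 : k%:R != 0 :> R. Proof. by rewrite pnatr_eq0 -lt0n. Qed.

Lemma vr_copies_le x : (c x)%:R <= P x * k%:R.
Proof. by rewrite truncn_le mulr_ge0 //; case: P_distr. Qed.

Lemma resid_ge0 x : 0 <= P x - (c x)%:R / k%:R.
Proof. by rewrite subr_ge0 ler_pdivrMr ?ltr0n // vr_copies_le. Qed.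

Lemma count_vr_det x : count_mem x (vr_det P k) = c x.
Proof.
rewrite count_flatten -map_comp sumnE big_map big_enum /= (bigD1 x) //=.
rewrite count_nseq /= eqxx mul1n big1 ?addn0 // => y /negbTE yx.
by rewrite count_nseq /= yx.
Qed.

Lemma size_vr_det : size (vr_det P k) = (\sum_x c x)%N.
Proof.
rewrite size_flatten /shape -map_comp sumnE big_map big_enum /=.
by apply: eq_bigr => x _; rewrite size_nseq.
Qed.

(** The natural subtraction in [vr_rem] does not truncate, as the floors sum to at most [k]. *)
Lemma size_vr_det_rem : (size (vr_det P k) + vr_rem P k)%N = k.
Proof.
rewrite size_vr_det subnKC // -(ler_nat R) natr_sum.
apply: le_trans (ler_sum _ (fun x _ => vr_copies_le x)) _.
by rewrite -mulr_suml (proj2 P_distr) mul1r.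
Qed.

Lemma sum_resid : \sum_y (P y - (c y)%:R / k%:R) = (vr_rem P k)%:R / k%:R.
Proof.
rewrite sumrB (proj2 P_distr) -mulr_suml -natr_sum -size_vr_det.
apply/eqP; rewrite subr_eq -mulrDl -natrD addnC size_vr_det_rem.
by rewrite mulfV.
Qed.

Lemma vr_resid_ge0 x : 0 <= vr_resid P k x.
Proof. by rewrite divr_ge0 ?resid_ge0 // sumr_ge0 // => y _; apply: resid_ge0. Qed.

Lemma sum_vr_resid : (0 < vr_rem P k)%N -> \sum_x vr_resid P k x = 1.
Proof.
move=> r_gt0; rewrite -mulr_suml mulfV // sum_resid.
by rewrite mulf_neq0 ?invr_eq0 // pnatr_eq0 -lt0n.
Qed.

(* If no point remains, [vr_resid] is the junk value [0 / 0 = 0], but then every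
   residual vanishes as well. *)
Lemma vr_rem_resid x :
  (vr_rem P k)%:R * vr_resid P k x = P x * k%:R - (c x)%:R.
Proof.
have [r0|r_gt0] := posnP (vr_rem P k).
  have /(_ x isT)/eqP := psumr_eq0P (fun y _ => resid_ge0 y)
    (etrans sum_resid (etrans (congr1 (fun r => r%:R / k%:R) r0) (mul0r _))).
  by rewrite subr_eq0 r0 mul0r => /eqP ->; rewrite mulfVK // subrr.
rewrite /vr_resid sum_resid -/c invf_div.
have r_neq0 : (vr_rem P k)%:R != 0 :> R by rewrite pnatr_eq0 -lt0n.
by field; rewrite k_neq0 r_neq0.
Qed.

End VarianceReduced.

(** * The factor 4 for VRRP *)

Lemma krp_costE (R : archiRealFieldType) (T : finType) (d : T -> T -> R)
    (P : T -> R) (k : nat) (S : seq T) :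
  krp_cost d P k S =
  prodE (fun _ : 'I_k => P) (fun X => dk d S [tuple X i | i < k]).
Proof.
rewrite /krp_cost sum_tuple_ffun; apply: eq_bigr => X _; congr (_ * _).
by rewrite big_tuple; apply: eq_bigr => i _; rewrite tnth_mktuple.
Qed.

Unset Implicit Arguments.
Set Strict Implicit.

Theorem theorem4 (R : archiRealFieldType) (T : finType) (d : T -> T -> R)
  (P : T -> R) (k : nat) (O : k.-tuple T) :
  is_metric d -> is_distr P -> (0 < k)%N ->
  (forall S : k.-tuple T, krp_cost d P k O <= krp_cost d P k S) ->
  vrrp_expect P k (krp_cost d P k) <= 4 * krp_cost d P k O.
Proof.
move=> d_metric P_distr k_gt0 _.
have [P0 P1] := P_distr.
pose x0 := tnth O (Ordinal k_gt0).
pose D := vr_det P k; pose Q := vr_resid P k.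
have sz : (size D + vr_rem P k)%N = k by exact: size_vr_det_rem.
have Q1 : (0 < vr_rem P k)%N -> \sum_x Q x = 1 by exact: sum_vr_resid.
pose mu (j : 'I_k) := prefix_law x0 D Q j.
have mu0 j x : 0 <= mu j x by apply: prefix_law_ge0; exact: vr_resid_ge0.
have mu1 j : \sum_x mu j x = 1 by exact: sum_prefix_law_eq1 sz Q1.
(* The floor copies of [x] plus its expected number of random copies make [P x * k%:R]. *)
have Pavg x : P x = \sum_j k%:R^-1 * mu j x.
  rewrite -mulr_sumr (sum_prefix_law x0 Q x sz) count_vr_det vr_rem_resid //.
  by rewrite addrC subrK mulrC mulfK // pnatr_eq0 -lt0n.
rewrite /vrrp_expect -(prodE_prefix_law x0 _ sz Q1) -/mu.
(* The two summands pay for the legs from [S] to [O] and from [O] to [X]. *)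
have -> : 4 * krp_cost d P k O = 3 * krp_cost d P k O + krp_cost d P k O.
  by rewrite -[X in _ + X]mul1r -mulrDl; congr (_ * _); lra.
have le3 := expect_dk_le O d_metric k_gt0 mu0 mu1 Pavg.
rewrite -krp_costE in le3.
apply: le_trans (lerD le3 (lexx _)).
rewrite -[X in _ + X](prodE_cst _ mu1) -prodED.
apply: prodE_le => // S; rewrite !krp_costE.
have P1' (i : 'I_k) : \sum_x P x = 1 by [].
rewrite -[X in X + _](prodE_cst _ P1') -prodED.
by apply: prodE_le => // X; apply: dk_triangle.
Qed.
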